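(* Let $y_0,y_f\in X$, $T>0$, $\tilde y_T:=y_f-S_Ty_0$, and $P_r=\mathrm{cone}(\mathcal U_r)$. Then the condition $$\forall p_f\in X,\qquad F^*(L_T^*p_f)=0\ \Longrightarrow\ \langle\tilde y_T,p_f\rangle_X\le0$$ is equivalent to $$\forall p_f\in X,\qquad \big(\text{for a.e. }t\in(0,T),\ L_T^*p_f(t)\in P_r^\circ\big)\ \Longrightarrow\ \langle\tilde y_T,p_f\rangle_X\le0.$$
   Context: $X$ and $U$ are real Hilbert spaces, $T>0$, $E:=L^2(0,T;U)$. $A:\mathcal D(A)\to X$ generates a $C_0$-semigroup $(S_t)_{t\ge0}$ on $X$, $B\in L(U,X)$. $L_T\in L(E,X)$ is $L_Tu:=\int_0^TS_{T-t}Bu(t)\,dt$, with adjoint $L_T^*\in L(X,E)$, $L_T^*p_f(t)=B^*S_{T-t}^*p_f$. $\mathcal U\subset U$ is a fixed bounded set with $0\in\mathcal U$; $\mathcal U_r:=\overline{\mathrm{conv}}(\mathcal U)$ is its closed convex hull; for a set $K$, $\mathrm{cone}(K):=\{\lambda p:\ p\in K,\lambda>0\}$; $P_r^\circ:=\{y\in U:\ \langle x,y\rangle\le0\ \forall x\in P_r\}$ is the polar cone. $\sigma_{\mathcal U_r}(x):=\sup_{v\in\mathcal U_r}\langle x,v\rangle$ and $F^*(p):=\frac12\int_0^T\sigma_{\mathcal U_r}(p(t))^2\,dt$ for $p\in E$. *)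

(* Defs.v *)
From HB Require Import structures.
From mathcomp Require Import all_boot all_order all_algebra.
From mathcomp Require Import all_classical all_reals all_analysis.

Set Implicit Arguments.
Unset Strict Implicit.
Unset Printing Implicit Defensive.

Import Order.TTheory GRing.Theory Num.Theory.
Import numFieldNormedType.Exports.

Local Open Scope classical_set_scope.
Local Open Scope ring_scope.

(* A real Hilbert space is a [completeNormedModType R] together with an inner
   product [d : {dot V for idfun}] that induces its norm. *)
Definition hilbert_dot (R : realType) (V : completeNormedModType R)
    (d : {dot V for @idfun R}) : Prop :=
  forall x : V, `|x| ^+ 2 = d x x.

(* [S t] is only meaningful for [0 <= t]; nothing is required of it for
   negative times. *)
Definition c0_semigroup (R : realType) (X : normedModType R)
    (S : R -> {linear X -> X}) : Prop :=
  [/\ forall t : R, 0 <= t -> continuous (S t),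
      forall x : X, S 0 x = x,
      forall (s t : R) (x : X), 0 <= s -> 0 <= t -> S (s + t) x = S s (S t x) &
      forall x : X, S t x @[t --> 0^'+] --> x].

(* The unbounded operator [A : D(A) -> X] is a function on [X] together with a
   domain [DA]; the values of [A] outside [DA] are irrelevant. *)
Definition is_generator (R : realType) (X : normedModType R)
    (DA : set X) (A : X -> X) (S : R -> {linear X -> X}) : Prop :=
  DA = [set x : X | cvg (h^-1 *: (S h x - x) @[h --> 0^'+])] /\
  forall x : X, DA x -> h^-1 *: (S h x - x) @[h --> 0^'+] --> A x.

Definition simple_fun (R : realType) (V : normedModType R)
    (s : {fimfun R >-> V}) : Prop :=
  forall y : V, measurable (s @^-1` [set y]).

Definition simple_integral (R : realType) (V : normedModType R) (D : set R)
    (s : {fimfun R >-> V}) : V :=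
  \sum_(y \in range s) fine (lebesgue_measure (D `&` s @^-1` [set y])) *: y.

Definition ae_cvg (R : realType) (V : normedModType R) (D : set R)
    (s : nat -> {fimfun R >-> V}) (f : R -> V) : Prop :=
  {ae @lebesgue_measure R, forall t : R, D t -> s n t @[n --> \oo] --> f t}.

Definition strongly_measurable (R : realType) (V : normedModType R)
    (D : set R) (f : R -> V) : Prop :=
  exists s : nat -> {fimfun R >-> V},
    (forall n, simple_fun (s n)) /\ ae_cvg D s f.

(* The Bochner integral over a set [D] of finite measure. *)
Definition is_bochner_integral (R : realType) (V : normedModType R)
    (D : set R) (f : R -> V) (x : V) : Prop :=
  exists s : nat -> {fimfun R >-> V},
    [/\ forall n, simple_fun (s n),
        ae_cvg D s f,
        (\int[@lebesgue_measure R]_(t in D) (`|f t - s n t|)%:E)%E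
          @[n --> \oo] --> 0%E &
        simple_integral D (s n) @[n --> \oo] --> x].

Definition bochner_integral (R : realType) (V : normedModType R)
    (D : set R) (f : R -> V) : V :=
  xget 0 [set x : V | is_bochner_integral D f x].

(* The space E = L^2(0,T;U), by representatives: two functions denote the same
   element when they agree almost everywhere on ]0, T[. *)
Definition L2 (R : realType) (U : normedModType R) (T : R) : set (R -> U) :=
  [set u | strongly_measurable `]0, T[ u /\
    (\int[@lebesgue_measure R]_(t in `]0%R, T[) (`|u t| ^+ 2)%:E < +oo)%E].

Definition L2dot (R : realType) (U : normedModType R) (d : U -> U -> R) (T : R)
    (u v : R -> U) : R :=
  \int[@lebesgue_measure R]_(t in `]0, T[) d (u t) (v t).

Definition L_T (R : realType) (X U : normedModType R)
    (S : R -> {linear X -> X}) (B : U -> X) (T : R) (u : R -> U) : X :=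
  bochner_integral `]0, T[ (fun t => S (T - t) (B (u t))).

(* [Ls] sends each [p : X] to a representative of the element [L^* p] of
   L^2(0,T;U). *)
Definition is_L2_adjoint (R : realType) (X U : normedModType R)
    (dX : X -> X -> R) (dU : U -> U -> R) (T : R)
    (L : (R -> U) -> X) (Ls : X -> R -> U) : Prop :=
  (forall p : X, L2 T (Ls p)) /\
  forall (u : R -> U) (p : X), L2 T u -> dX (L u) p = L2dot dU T u (Ls p).

Definition closed_conv (R : realType) (V : normedModType R) (K : set V) :
    set V :=
  closure (smallest (@convex_set R V) K).

Definition cone (R : realType) (V : normedModType R) (K : set V) : set V :=
  [set x | exists2 p, K p & exists2 l : R, 0 < l & x = l *: p].

Definition polar (R : realType) (V : normedModType R) (d : V -> V -> R)
    (P : set V) : set V :=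
  [set y | forall x, P x -> d x y <= 0].

Definition support_fun (R : realType) (V : normedModType R) (d : V -> V -> R)
    (K : set V) (x : V) : R :=
  sup [set d x v | v in K].

(* Extended-real valued, since the integral is; it is finite on L^2 when [K]
   is bounded and nonempty. *)
Definition Fstar (R : realType) (U : normedModType R) (d : U -> U -> R)
    (K : set U) (T : R) (p : R -> U) : \bar R :=
  ((2^-1)%:E * \int[@lebesgue_measure R]_(t in `]0%R, T[)
                 ((support_fun d K (p t)) ^+ 2)%:E)%E.

(* Main.v *)
Require Import Defs.
From HB Require Import structures.
From mathcomp Require Import all_boot all_order all_algebra.
From mathcomp Require Import all_classical all_reals all_analysis.
From mathcomp Require Import unstable measurable_realfun ring lra.

(** For a bounded set [K] containing 0, the support function [sigma_K] is
    nonnegative, and [sigma_K x = 0] says that [<x, v> <= 0] for every [v] in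
    [K], which is membership of [x] in the polar of [cone K] (positive factors
    do not change signs): [support_fun_eq0].  Since [Fstar] integrates
    [sigma_K ^+ 2], it vanishes at [p] exactly when [sigma_K (p t) = 0] for
    almost every [t], hence exactly when [p t] is almost everywhere in the polar
    cone: [Fstar_eq0].  Applied to [K = closed_conv calU] and to [p = LTs pf],
    this makes the premises of the two implications equivalent for each [pf].

    What needs care is measurability.  A strongly measurable [p] is an almost
    everywhere limit of simple functions, so [sigma_K \o p] is Borel measurable
    only off a null set [N], and Lebesgue measure on Borel sets is not complete.
    The vanishing criterion for integrals is therefore proved for functions that
    are measurable off a null set ([integral_eq0_ae]); measurability off [N]
    follows from the Lipschitz continuity of [sigma_K]
    ([support_fun_lipschitz]), where the boundedness of [K] enters through the
    Cauchy-Schwarz inequality. *)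

Set Implicit Arguments.
Unset Strict Implicit.
Unset Printing Implicit Defensive.

Import Order.TTheory GRing.Theory Num.Theory.
Import numFieldNormedType.Exports.

Local Open Scope classical_set_scope.
Local Open Scope ring_scope.

(** Cauchy-Schwarz: multiplied by [|y| ^+ 2], the difference of the squares of
    the two sides becomes a squared norm, that of [|y| ^+ 2] times the component
    of [x] orthogonal to [y]. *)
Lemma norm_dot_le (R : realType) (V : completeNormedModType R)
    (d : {dot V for @idfun R}) (hd : hilbert_dot d) (x y : V) :
  `|d x y| <= `|x| * `|y|.
Proof.
have [->|y0] := eqVneq y 0; first by rewrite linear0r !normr0 mulr0.
have y2 : 0 < `|y| ^+ 2 by rewrite exprn_gt0// normr_gt0.
rewrite -ler_sqr ?nnegrE ?mulr_ge0// real_normK ?num_real// exprMn.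
rewrite -subr_ge0 -(pmulr_lge0 _ y2).
have <- : `|d y y *: x - d x y *: y| ^+ 2 =
    (`|x| ^+ 2 * `|y| ^+ 2 - d x y ^+ 2) * `|y| ^+ 2.
  have dyx : d y x = d x y by rewrite hermC expr0 mul1r.
  rewrite !hd linearBl !linearBr/= !linearZl_LR !linearZr_LR/= dyx.
  by rewrite /GRing.scale/=; ring.
exact: sqr_ge0.
Qed.

(** A closed ball is convex and closed, so it contains the closed convex hull of
    each of its subsets. *)
Lemma closed_conv_norm_le (R : realType) (V : normedModType R)
    (K : set V) (M : R) :
  (forall v, K v -> `|v| <= M) -> forall v, closed_conv K v -> `|v| <= M.
Proof.
move=> KM; pose B := [set v : V | `|v| <= M].
have Bconv : convex_set (B : set (convex_lmodType V)).
  apply/convex_setW => x y /[!inE] xM yM k k0 k1.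
  rewrite /B inE/=.
  rewrite (le_trans (ler_normD _ _))// !normrZ.
  rewrite (ger0_norm (ltW k0)) ger0_norm ?onem_ge0 ?(ltW k1)//= /onem.
  have -> : M = k%:num * M + (1 - k%:num) * M by ring.
  by rewrite lerD// ler_wpM2l// ?subr_ge0 ltW.
have Bclosed : closed B.
  apply: (@closed_comp _ _ _ [set r : R | r <= M]); last exact: closed_le.
  by move=> v _; exact: norm_continuous.
move=> v Kv; have : closure B v by apply: closureS Kv; exact: smallest_sub.
by rewrite -(closure_id B).1.
Qed.

Section support_function.
Variables (R : realType) (V : completeNormedModType R).
Variables (d : {dot V for @idfun R}) (hd : hilbert_dot d).
Variables (K : set V) (M : R).
Hypotheses (KM : forall v, K v -> `|v| <= M) (K0 : K 0).

Lemma has_sup_dot (x : V) : has_sup [set d x v | v in K].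
Proof.
split; first by exists (d x 0), 0.
exists (`|x| * M) => _ [v Kv <-].
rewrite (le_trans (ler_norm _))// (le_trans (norm_dot_le hd x v))//.
by rewrite ler_wpM2l// KM.
Qed.

Lemma dot_le_support_fun (x v : V) : K v -> d x v <= support_fun d K x.
Proof. by move=> Kv; apply: sup_ubound; [exact: (has_sup_dot x).2|exists v]. Qed.

Lemma support_fun_ge0 (x : V) : 0 <= support_fun d K x.
Proof. by rewrite -(linear0r d x); exact: dot_le_support_fun. Qed.

Lemma support_fun_eq0 (x : V) :
  support_fun d K x = 0 <-> polar d (cone K) x.
Proof.
split=> [sx0 _ [v Kv [l l0 ->]]|Kx].
  rewrite linearZl_LR/= hermC expr0 mul1r/=.
  by rewrite pmulr_rle0// -sx0 dot_le_support_fun.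
apply/eqP; rewrite eq_le support_fun_ge0 andbT.
apply: ge_sup; first exact: (has_sup_dot x).1.
move=> _ [v Kv <-]; rewrite hermC expr0 mul1r/=; apply: Kx.
by exists v => //; exists 1; rewrite ?scale1r.
Qed.

(** The functions [d _ v], for [v] in [K], share the Lipschitz constant [M], and
    a supremum inherits it. *)
Lemma support_fun_lipschitz (x y : V) :
  support_fun d K x <= support_fun d K y + M * `|x - y|.
Proof.
apply: ge_sup; first exact: (has_sup_dot x).1.
move=> _ [v Kv <-]; rewrite -{1}(subrK y x) addrC linearDl.
apply: lerD; first exact: dot_le_support_fun.
rewrite (le_trans (ler_norm _))// (le_trans (norm_dot_le hd _ v))//.
by rewrite mulrC ler_wpM2r// KM.
Qed.

Lemma support_fun_continuous : continuous (support_fun d K : V -> R^o).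
Proof.
move=> x; apply/cvgrPdist_le => e e0.
have M0 : 0 <= M by rewrite -(normr0 V) KM.
(* [M] may be 0, so the radius of the neighbourhood is [e / (M + 1)]. *)
have M1 : 0 < M + 1 by rewrite ltr_wpDl.
near=> y.
have xy : (M + 1) * `|x - y| <= e.
  rewrite mulrC -ler_pdivlMr//; near: y.
  apply: cvgr_dist_le; [exact: cvg_id|exact: divr_gt0].
have := support_fun_lipschitz x y; have := support_fun_lipschitz y x.
rewrite (distrC y x) ler_norml; have := normr_ge0 (x - y). nra.
Unshelve. all: by end_near. Qed.

End support_function.

(** Each preimage under [f \o s] is a finite union of fibres of [s]. *)
Lemma measurable_comp_simple_fun (R : realType) (V : normedModType R)
    (s : {fimfun R >-> V}) (f : V -> R) (D : set R) :
  simple_fun s -> measurable_fun D (f \o s).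
Proof.
move=> ms; apply: (measurable_funS measurableT) => // _ Y mY; rewrite setTI.
rewrite (_ : _ @^-1` Y = \bigcup_(y in range s `&` f @^-1` Y) s @^-1` [set y]).
  apply: fin_bigcup_measurable => [|y _]; last exact: ms.
  exact: finite_setIl.
apply/seteqP; split => [t Yt|t [y [_ Yy]] /= ty].
by exists (s t) => //; split => //; exists t.
by rewrite /preimage/= ty.
Qed.

(** Off the null set where the approximating simple functions fail to converge,
    [f \o p] is a pointwise limit of measurable functions. *)
Lemma measurable_comp_strongly_measurable (R : realType) (V : normedModType R)
    (D : set R) (p : R -> V) (f : V -> R) :
  continuous (f : V -> R^o) -> strongly_measurable D p ->
  exists2 N : set R, measurable N /\ @lebesgue_measure R N = 0%E &
    measurable_fun (D `\` N) (f \o p).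
Proof.
move=> cf [s [ms [N [mN N0 sN]]]]; exists N => //.
apply: (@measurable_fun_cvg _ _ _ _ (fun n => f \o s n)) => [n|t [Dt Nt]].
  exact: measurable_comp_simple_fun.
have st : s n t @[n --> \oo] --> p t.
  by apply: contrapT => st; apply: Nt; apply: sN => /(_ Dt).
exact: (cvg_comp _ _ st (cf (p t))).
Qed.

Section lower_integral.
Local Open Scope ereal_scope.
Context d (T : measurableType d) (R : realType).
Variable mu : {measure set T -> \bar R}.
Implicit Types (f g : T -> \bar R) (D N : set T).

(** The integral of a nonnegative function is the supremum of the integrals of
    the simple functions below it, and a larger integrand has more of them. *)
Lemma ge0_le_integral_nonmeasurable f g :
  (forall x, 0 <= f x) -> (forall x, f x <= g x) ->
  \int[mu]_x f x <= \int[mu]_x g x.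
Proof.
move=> f0 fg; rewrite !ge0_integralTE//; last first.
  by move=> x; exact: le_trans (fg x).
apply: le_ereal_sup => _ [h hf <-]; exists h => // x.
exact: le_trans (fg x).
Qed.

Lemma ae_imply (P Q : T -> Prop) :
  (forall x, P x -> Q x) -> {ae mu, forall x, P x} -> {ae mu, forall x, Q x}.
Proof. by move=> PQ; apply: filterS. Qed.

(** The integral of [f] over [D] lies between two integrals of measurable
    functions: that of [f] over [D `\` N], which vanishes only if [f] is almost
    everywhere 0 there, and, when [f] is 0 off a null set [N'], that of the
    function equal to [+oo] on [N'] and to 0 elsewhere, which is 0. *)
Lemma integral_eq0_ae D N f :
  measurable D -> measurable N -> mu N = 0 -> measurable_fun (D `\` N) f ->
  (forall x, D x -> 0 <= f x) ->
  \int[mu]_(x in D) f x = 0 <-> {ae mu, forall x, D x -> f x = 0}.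
Proof.
move=> mD mN N0 mf f0; have mDN := measurableD mD mN.
split=> [If0|[N' [mN' N'0 fN']]].
- have IN0 : \int[mu]_(x in D `\` N) `|f x| = 0.
    apply/eqP; rewrite eq_le integral_ge0// andbT -If0.
    rewrite integral_mkcond [leRHS]integral_mkcond.
    apply: ge0_le_integral_nonmeasurable => x; rewrite /patch.
      by case: ifP.
    case: ifPn => [|_]; last by case: ifPn => // /set_mem /f0.
    by rewrite inE => -[Dx Nx]; rewrite ifT ?inE// gee0_abs ?f0.
  have := (ae_eq_integral_abs mu mDN mf).1 IN0.
  have : {ae mu, forall x, ~ N x}.
    by exists N; split => // x /= /contrapT.
  by apply: filterS2 => x Nx fx Dx; exact: fx.
- apply/eqP; rewrite eq_le integral_ge0// andbT.
  pose g : T -> \bar R := (fun=> +oo) \_ N'.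
  have mg : measurable_fun D g.
    apply: (measurable_funS measurableT) => //.
    by apply/(measurable_restrictT _ mN').
  have <- : \int[mu]_(x in D) g x = 0.
    rewrite (ge0_ae_eq_integral (g := cst 0) mD)// ?integral0//.
      by move=> x _; rewrite /g/patch; case: ifP.
    exists N'; split => // x /= gx; apply: contrapT => N'x; apply: gx => _.
    by rewrite /g patchE memNset.
  rewrite integral_mkcond [leRHS]integral_mkcond.
  apply: ge0_le_integral_nonmeasurable => x; rewrite /patch.
    by case: ifPn => // /set_mem /f0.
  case: ifPn => // /set_mem Dx; rewrite /g patchE; case: ifPn => [_|/negP N'x].
    by rewrite leey.
  rewrite le_eqVlt; apply/orP; left; apply/eqP.
  by apply: contrapT => fx; apply: N'x; rewrite inE; apply: fN' => /(_ Dx).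
Qed.

End lower_integral.

(** The integrand [sigma_K (p t) ^+ 2] is nonnegative, so the integral vanishes
    exactly when [sigma_K (p t) = 0] almost everywhere. *)
Lemma Fstar_eq0 (R : realType) (U : completeNormedModType R)
    (d : {dot U for @idfun R}) (hd : hilbert_dot d) (K : set U) (M T : R)
    (KM : forall v, K v -> `|v| <= M) (K0 : K 0)
    (p : R -> U) (mp : strongly_measurable `]0, T[ p) :
  Fstar d K T p = 0%E <->
  {ae @lebesgue_measure R, forall t,
    `]0, T[%classic t -> polar d (cone K) (p t)}.
Proof.
have [N [mN N0] mpN] := measurable_comp_strongly_measurable
  (support_fun_continuous hd KM K0) mp.
have msq : measurable_fun (`]0, T[ `\` N)
    (fun t => (support_fun d K (p t) ^+ 2)%:E).
  by apply/measurable_EFinP; exact: measurable_funX.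
have := integral_eq0_ae (mu := @lebesgue_measure R)
  (measurable_itv _) mN N0 msq.
have Feq0 : Fstar d K T p = 0%E <->
    (\int[@lebesgue_measure R]_(t in `]0%R, T[)
      ((support_fun d K (p t)) ^+ 2)%:E = 0)%E.
  rewrite /Fstar; split=> [/eqP|->]; last by rewrite mule0.
  by rewrite mule_eq0 eqe invr_eq0 pnatr_eq0/= => /eqP.
rewrite Feq0 => ->; last by move=> t _; rewrite lee_fin sqr_ge0.
split=> ae_p; apply: (ae_imply (mu := @lebesgue_measure R)) ae_p => t pt Dt.
  have /eqP := pt Dt; rewrite eqe sqrf_eq0 => /eqP.
  exact: (support_fun_eq0 hd KM K0 _).1.
by rewrite ((support_fun_eq0 hd KM K0 _).2 (pt Dt)) expr0n.
Qed.

Theorem lemma1p1 (R : realType) (X U : completeNormedModType R)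
    (dX : {dot X for @idfun R}) (dU : {dot U for @idfun R})
    (hX : hilbert_dot dX) (hU : hilbert_dot dU)
    (DA : set X) (A : X -> X) (S : R -> {linear X -> X})
    (hS : c0_semigroup S) (hA : is_generator DA A S)
    (B : {linear U -> X}) (hB : continuous B)
    (T : R) (hT : 0 < T)
    (LTs : X -> R -> U) (hLTs : is_L2_adjoint dX dU T (L_T S B T) LTs)
    (calU : set U) (calU_bounded : bounded_set calU) (calU0 : calU 0)
    (y0 yf : X) :
  (forall pf : X,
      Fstar dU (closed_conv calU) T (LTs pf) = 0%E ->
      dX (yf - S T y0) pf <= 0)
  <->
  (forall pf : X,
      {ae @lebesgue_measure R, forall t : R, t \in `]0, T[ ->
        polar dU (cone (closed_conv calU)) (LTs pf t)} ->
      dX (yf - S T y0) pf <= 0).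
Proof.
have [M _ calUM] : exists2 M, True & forall v, calU v -> `|v| <= M.
  have [M [_ calUM]] := calU_bounded.
  by exists (M + 1) => // v; apply: calUM; rewrite ltrDl.
have KM := closed_conv_norm_le calUM.
have K0 : closed_conv calU 0 by apply: subset_closure; exact: sub_gen_smallest.
have Feq0 pf := Fstar_eq0 hU KM K0 (hLTs.1 pf).1.
split=> H pf Hpf; apply: H.
  by apply/Feq0; apply: (ae_imply (mu := @lebesgue_measure R))
    Hpf => t pt Dt; apply: pt.
move/Feq0: Hpf; apply: (ae_imply (mu := @lebesgue_measure R)) => t pt Dt.
exact: pt.
Qed.
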